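(* Given a set of $n$ distinct elements from a totally ordered universe (accessible only through pairwise comparisons) and integers $i,j\ge 1$ with $i+j+2(i+j)^{3/4}\le n$, there is a randomized comparison-based algorithm that always outputs an $(i,j)$-mediocre element and whose expected number of comparisons is $(i+j)+O\big((i+j)^{3/4}\big)$ as $i+j\to\infty$.
   Context: For nonnegative integers $i,j$, an element of a totally ordered set $S$ of $n$ elements is called $(i,j)$-mediocre if it is neither among the $i$ largest nor among the $j$ smallest elements of $S$. The expectation is over the algorithm's internal randomness, for the worst-case input. *)

(* Defs.v *)
From HB Require Import structures.
From mathcomp Require Import all_boot all_order all_algebra all_fingroup.
From mathcomp Require Import all_classical all_reals all_analysis.
Set Implicit Arguments. Unset Strict Implicit. Unset Printing Implicit Defensive.
Import Order.TTheory GRing.Theory Num.Theory.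

(* A deterministic comparison-based algorithm on n elements, named by 'I_n,
   is a (finite) decision tree: an internal node [Query a b t1 t2] compares
   elements a and b and continues with t1 if a < b, with t2 otherwise;
   a leaf outputs an element. *)
Inductive dtree (n : nat) : Type :=
| Leaf of 'I_n
| Query of 'I_n & 'I_n & dtree n & dtree n.

(* An input: a set of n distinct elements of a totally ordered universe is,
   for comparison purposes, given by the rank of each element:
   [sigma x] = number of elements smaller than x (0-based rank). *)
Definition input (n : nat) := {perm 'I_n}.

Fixpoint output n (t : dtree n) (sigma : input n) : 'I_n :=
  match t with
  | Leaf x => x
  | Query a b t1 t2 => if (sigma a < sigma b)%N then output t1 sigma
                       else output t2 sigma
  end.

Fixpoint ncomparisons n (t : dtree n) (sigma : input n) : nat :=
  match t with
  | Leaf _ => 0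
  | Query a b t1 t2 => (if (sigma a < sigma b)%N then ncomparisons t1 sigma
                        else ncomparisons t2 sigma).+1
  end.

Definition mediocre n (i j : nat) (sigma : input n) (x : 'I_n) : bool :=
  (j <= sigma x) && (sigma x < n - i).

(* A randomized comparison-based algorithm: a probability distribution with
   countable support over deterministic decision trees. *)
Record rand_alg (R : realType) (n : nat) := RandAlg {
  ra_weight : nat -> R;
  ra_tree : nat -> dtree n }.

Local Open Scope ring_scope.

Definition is_distribution (R : realType) n (A : rand_alg R n) : Prop :=
  (forall k, 0 <= ra_weight A k) /\
  (\sum_(0 <= k <oo) (ra_weight A k)%:E = 1)%E.

Definition always_mediocre (R : realType) n (i j : nat) (A : rand_alg R n) : Prop :=
  forall k (sigma : input n), mediocre i j sigma (output (ra_tree A k) sigma).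

Definition expected_comparisons (R : realType) n (A : rand_alg R n)
  (sigma : input n) : \bar R :=
  (\sum_(0 <= k <oo) (ra_weight A k * (ncomparisons (ra_tree A k) sigma)%:R)%:E)%E.

(* Main.v *)
(* Put m = i + j, let u be maximal with u^12 <= m, and restrict to N = m + 2 u^9
   of the elements. Draw u^8 of them uniformly with replacement, sort the sample,
   and take as pivot p its element of index q ~ u^8 (j + u^9) / N. Comparing p with
   all N elements costs N = m + O(m^(3/4)) and reveals whether p is mediocre; if it
   is not, sort all N elements. The pivot is bad only if the number of sampled
   elements below one of two rank thresholds deviates by at least t = u^17 / N from
   its mean. The fourth moment of this deviation is at most 3 u^16, so by Markov the
   failure probability is O(u^16 / t^4) = O(u^-4), and the fallback, which costs
   O(u N) = O(u^13), contributes only O(u^9) = O(m^(3/4)) on average. *)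

Require Import Defs.
From HB Require Import structures.
From mathcomp Require Import all_boot all_order all_algebra all_fingroup.
From mathcomp Require Import zify ring lra.
From mathcomp Require Import all_classical all_reals all_analysis.
Import Order.TTheory GRing.Theory Num.Theory.
Local Open Scope ring_scope.

(** * Order by rank; comparison trees for merging, sorting and ranking *)

Definition rank_le {n} (sigma : input n) : rel 'I_n :=
  fun x y => (sigma x <= sigma y)%N.

Lemma rank_le_total {n} (sigma : input n) : total (rank_le sigma).
Proof. by move=> x y; exact: leq_total. Qed.

Lemma rank_le_trans {n} (sigma : input n) : transitive (rank_le sigma).
Proof. by move=> y x z; exact: leq_trans. Qed.

Lemma rank_le_anti {n} (sigma : input n) : antisymmetric (rank_le sigma).
Proof. by move=> x y; rewrite -eqn_leq => /eqP/val_inj/perm_inj. Qed.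

(* The comparison trees below are written in continuation-passing style:
   [k] maps the result of a subroutine to the tree that is run next. *)
Fixpoint tmerge {n} (s1 : seq 'I_n) : seq 'I_n -> (seq 'I_n -> dtree n) -> dtree n :=
  if s1 is x :: s1' then
    fix tmerge_s1 s2 k :=
      if s2 is y :: s2' then
        Query y x (tmerge_s1 s2' (fun r => k (y :: r)))
                  (tmerge s1' s2 (fun r => k (x :: r)))
      else k s1
  else fun s2 k => k s2.

(** Merge sort with depth [d] as fuel, meant for at most [2 ^ d] elements: cutting at [2 ^ d'] keeps
    both parts within the bound for [d'], and each level merges at a cost of at most the total
    size. *)
Fixpoint tsort {n} (d : nat) (s : seq 'I_n) (k : seq 'I_n -> dtree n) : dtree n :=
  if d is d'.+1 then
    tsort d' (take (2 ^ d') s) (fun r1 =>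
      tsort d' (drop (2 ^ d') s) (fun r2 => tmerge r1 r2 k))
  else k s.

Fixpoint trank {n} (p : 'I_n) (s : seq 'I_n) (k : nat -> dtree n) : dtree n :=
  if s is x :: s' then
    Query x p (trank p s' (fun r => k r.+1)) (trank p s' k)
  else k 0%N.

Definition rank_in {n} (sigma : input n) (s : seq 'I_n) (x : 'I_n) : nat :=
  count (fun y => sigma y < sigma x)%N s.

Lemma tmergeP {n} (sigma : input n) s1 s2 k (t := tmerge s1 s2 k)
    (t' := k (merge (rank_le sigma) s1 s2)) :
  output t sigma = output t' sigma /\
  (ncomparisons t sigma <= size s1 + size s2 + ncomparisons t' sigma)%N.
Proof.
rewrite {}/t {}/t'; elim: s1 s2 k => [|x s1 IH1] s2 k; first by rewrite leq_addl.
elim: s2 k => [|y s2 IH2] k /=; first by rewrite leq_addl.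
(* The query asks whether [y] is below [x], the negation of the test by which [merge] picks its next
   element. *)
rewrite ltnNge -[(sigma x <= sigma y)%N]/(rank_le sigma x y).
case: (rank_le sigma x y) => /=.
  by have [-> /= c] := IH1 (y :: s2) (fun r => k (x :: r)); rewrite !addSn ltnS.
by have [-> /= c] := IH2 (fun r => k (y :: r)); rewrite addnS addSn ltnS.
Qed.

Lemma tsortP {n} (sigma : input n) d s k (t := tsort d s k)
    (t' := k (sort (rank_le sigma) s)) :
  (size s <= 2 ^ d)%N ->
  output t sigma = output t' sigma /\
  (ncomparisons t sigma <= d * size s + ncomparisons t' sigma)%N.
Proof.
rewrite {}/t {}/t'; elim: d s k => [|d IH] s k les /=.
  by move: s les => [|x [|y s]].
have le1 : (size (take (2 ^ d) s) <= 2 ^ d)%N by rewrite size_take; case: ltnP.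
have le2 : (size (drop (2 ^ d) s) <= 2 ^ d)%N.
  by rewrite size_drop leq_subLR addnn -mul2n -expnS.
have tot := rank_le_total sigma.
set r1 := sort (rank_le sigma) (take (2 ^ d) s).
set r2 := sort (rank_le sigma) (drop (2 ^ d) s).
(* Distinct elements have distinct ranks, so a multiset has only one sorted arrangement. *)
have sortE : sort (rank_le sigma) s = merge (rank_le sigma) r1 r2.
  apply: (sorted_eq (@rank_le_trans _ sigma) (@rank_le_anti _ sigma)).
  - exact: sort_sorted.
  - by apply: merge_sorted => //; exact: sort_sorted.
  - by rewrite perm_sort perm_sym perm_merge -[X in perm_eq _ X](cat_take_drop (2 ^ d) s)
      perm_cat // perm_sort.
have [-> c1] := IH _ (fun r1 => tsort d (drop (2 ^ d) s)
  (fun r2 => tmerge r1 r2 k)) le1.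
have [-> c2] := IH _ (fun r2 => tmerge r1 r2 k) le2.
have [-> c3] := tmergeP sigma r1 r2 k.
rewrite sortE; split=> //.
have szs : (size s = size (take (2 ^ d) s) + size (drop (2 ^ d) s))%N.
  by rewrite -size_cat cat_take_drop.
apply: (leq_trans c1); apply: (leq_trans (leq_add (leqnn _) c2)).
apply: (leq_trans (leq_add (leqnn _) (leq_add (leqnn _) c3))).
by rewrite szs !size_sort mulSn mulnDr; lia.
Qed.

Lemma trankP {n} (sigma : input n) p s k (t := trank p s k)
    (t' := k (rank_in sigma s p)) :
  output t sigma = output t' sigma /\
  ncomparisons t sigma = (size s + ncomparisons t' sigma)%N.
Proof.
rewrite {}/t {}/t' /rank_in; elim: s k => [|x s IH] k //=.
case: ifP => _; first by have [-> ->] := IH (fun r => k r.+1).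
by have [-> ->] := IH k.
Qed.

(** * Order statistics, ranks within a sublist, and mediocrity *)

(** The elements satisfying a down-closed predicate form a prefix of a sorted sequence. This turns
    statements about order statistics into counting. *)
Lemma nth_sorted_downclosed {T : Type} {le : rel T} (P : pred T) x0 s q :
  transitive le -> (forall x y, le x y -> P y -> P x) -> sorted le s ->
  (q < size s)%N -> P (nth x0 s q) = (q < count P s)%N.
Proof.
move=> tr dcl; elim: s q => [|x s IH] q //= xs lq.
have ss := path_sorted xs.
have [Px|nPx] := boolP (P x); first by case: q lq => [|q] //= lq; rewrite IH.
have ns : ~~ has P s.
  rewrite -all_predC; apply: sub_all (order_path_min tr xs) => y /= xy.
  by apply: contra nPx; exact: dcl.
have c0 : count P s = 0%N by apply/eqP; rewrite -leqn0 leqNgt -has_count.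
rewrite c0 ltn0; case: q lq => [|q] /= lq; first exact/negbTE.
by rewrite IH // c0.
Qed.

Lemma rank_in_perm {n} (sigma : input n) (s s' : seq 'I_n) :
  perm_eq s s' -> rank_in sigma s =1 rank_in sigma s'.
Proof. by move=> /seq.permP ss' x; exact: ss'. Qed.

Lemma rank_in_le {n} (sigma : input n) s x y :
  rank_le sigma x y -> (rank_in sigma s x <= rank_in sigma s y)%N.
Proof. by move=> xy; apply: sub_count => z /= zx; exact: leq_trans xy. Qed.

(** Ranks are injective, so passing from strict to weak inequality admits only [x] itself, which
    occurs at most once. *)
Lemma count_leq_rank {n} (sigma : input n) (s : seq 'I_n) x :
  uniq s -> (count (fun y => sigma y <= sigma x) s <= (rank_in sigma s x).+1)%N.
Proof.
move=> us; rewrite /rank_in -addn1.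
apply: (@leq_trans (count (predU (fun y => sigma y < sigma x)%N (pred1 x)) s)).
  apply: sub_count => y /=; rewrite leq_eqVlt => /orP[/eqP/val_inj/perm_inj ->|->] //.
  by rewrite eqxx orbT.
apply: leq_trans (leq_addr (count (predI (fun y => sigma y < sigma x)%N (pred1 x)) s) _) _.
by rewrite count_predUI leq_add2l count_uniq_mem // leq_b1.
Qed.

(** The prefix principle is applied to two down-sets of the element [z] at index [q]: strictly below
    [z], which misses [z], and weakly below [z], which contains it. *)
Lemma rank_in_nth {n} (sigma : input n) (s : seq 'I_n) x0 q :
  uniq s -> (q < size s)%N ->
  rank_in sigma s (nth x0 (sort (rank_le sigma) s) q) = q.
Proof.
move=> us lq; set r := sort _ s; set z := nth _ _ _.
have pr : perm_eq r s by rewrite perm_sort.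
have rs : sorted (rank_le sigma) r := sort_sorted (rank_le_total sigma) s.
have lqr : (q < size r)%N by rewrite size_sort.
rewrite -(rank_in_perm _ _ _ pr); apply/eqP; rewrite eqn_leq; apply/andP; split.
  rewrite leqNgt /rank_in.
  rewrite -(nth_sorted_downclosed _ x0 r q (@rank_le_trans _ sigma)) ?ltnn //.
  by move=> x y /= xy; exact: leq_ltn_trans.
rewrite -ltnS; apply: leq_trans (count_leq_rank sigma r z _); last first.
  by rewrite (perm_uniq pr).
rewrite -(nth_sorted_downclosed _ x0 r q (@rank_le_trans _ sigma)) //.
by move=> x y /= xy; exact: leq_trans.
Qed.

(** In sorted order the element at index [q] has rank [q], so [a] and the count cut off the same
    prefix. *)
Lemma count_rank_in_lt {n} (sigma : input n) (s : seq 'I_n) a :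
  uniq s -> (a <= size s)%N -> count (fun x => rank_in sigma s x < a)%N s = a.
Proof.
move=> us; case: s us => [|x0 s'] us; first by rewrite leqn0 => /eqP->.
set s := x0 :: s' => las; set P := (fun x => _ < a)%N.
rewrite -(seq.permP (permEl (perm_sort (rank_le sigma) s))); set r := sort _ s.
have szr : size r = size s by rewrite size_sort.
have key q : (q < size s)%N -> (q < a)%N = (q < count P r)%N.
  move=> lq; rewrite -(nth_sorted_downclosed P x0 r q (@rank_le_trans _ sigma)).
  - by rewrite /P rank_in_nth.
  - by move=> x y xy; apply: leq_ltn_trans; exact: rank_in_le.
  - exact: sort_sorted (rank_le_total sigma) _.
  - by rewrite szr.
have : (count P r <= size s)%N by rewrite -szr count_size.
case: (ltngtP (count P r) a) => // [lca|lac] lcs.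
  by have := key _ (leq_trans lca las); rewrite ltnn lca.
by have := key _ (leq_trans lac lcs); rewrite ltnn lac.
Qed.

Lemma count_rank_lt {n} (sigma : input n) v :
  (v <= n)%N -> count (fun y => sigma y < v)%N (enum 'I_n) = v.
Proof.
move=> vn.
rewrite -(count_map (fun y => sigma y) (fun y : 'I_n => y < v)%N).
have /seq.permP-> : perm_eq (map sigma (enum 'I_n)) (enum 'I_n).
  apply: uniq_perm; last 1 first.
  - move=> x; rewrite mem_enum /=; apply/mapP.
    by exists ((sigma^-1)%g x); rewrite ?mem_enum // permKV.
  - by rewrite map_inj_uniq ?enum_uniq //; exact: perm_inj.
  - exact: enum_uniq.
rewrite -(count_map val (fun y => y < v)%N) val_enum_ord -{1}(subnKC vn) iotaD.
rewrite count_cat (eq_in_count (a2 := predT)); last by move=> y; rewrite mem_iota.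
rewrite count_predT size_iota [X in (_ + X)%N](eq_in_count (a2 := pred0)).
  by rewrite count_pred0 addn0.
by move=> y; rewrite mem_iota /=; lia.
Qed.

(** This justifies discarding elements: the [j] smaller and [i] larger elements found inside [s]
    remain smaller and larger in the whole set. *)
Lemma mediocre_of_rank_in {n} (sigma : input n) (s : seq 'I_n) i j x :
  uniq s -> (j <= rank_in sigma s x)%N -> (rank_in sigma s x + i < size s)%N ->
  mediocre i j sigma x.
Proof.
move=> us jr ri.
have ssub : {subset s <= enum 'I_n} by move=> y _; rewrite mem_enum.
have sub_le (P : pred 'I_n) : (count P s <= count P (enum 'I_n))%N.
  by rewrite -!size_filter uniq_leq_size ?filter_uniq // => y;
    rewrite mem_filter [y \in [seq _ <- enum _ | _]]mem_filter mem_enum => /andP[->].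
have lo := sub_le (fun y => sigma y < sigma x)%N.
have hi := sub_le (predC (fun y => sigma y <= sigma x)%N).
have cs := count_predC (fun y => sigma y <= sigma x)%N s.
have ce := count_predC (fun y => sigma y <= sigma x)%N (enum 'I_n).
have e1 := count_rank_lt sigma (sigma x) (ltnW (ltn_ord _)).
have e2 : count (fun y => sigma y <= sigma x)%N (enum 'I_n) = (sigma x).+1.
  by rewrite -[RHS](count_rank_lt sigma) ?ltn_ord.
have := count_leq_rank sigma s x us.
move: ce lo hi cs jr ri; rewrite size_enum_ord e1 e2 /rank_in /mediocre.
move: (count _ s) (count _ s) (count (predC _) s) (count (predC _) (enum _)).
move: (size s) (nat_of_ord (sigma x)) => N r a b c d.
lia.
Qed.

(** * Moments of sums over samples drawn with replacement *)

(** The sample space of [s] independent uniform draws from [l]. Expectations appear below as plain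
    sums over it, hence multiplied by [N ^+ s], and inductions split off the first draw. *)
Fixpoint words {T} (l : seq T) (s : nat) : seq (seq T) :=
  if s is s'.+1 then [seq x :: w | x <- l, w <- words l s'] else [:: [::]].

Lemma size_words {T} (l : seq T) s : size (words l s) = (size l ^ s)%N.
Proof. by elim: s => //= s IH; rewrite size_allpairs IH expnS. Qed.

Lemma size_mem_words {T : eqType} (l : seq T) s w : w \in words l s -> size w = s.
Proof.
elim: s w => [|s IH] w /=; first by rewrite inE => /eqP->.
by case/allpairsP => -[x v] /= [_ /IH <- ->].
Qed.

Section Moments.
Variables (R : realDomainType) (T : Type) (l : seq T) (X : T -> R).
Hypotheses (X_centered : \sum_(x <- l) X x = 0) (X_le1 : forall x, `|X x| <= 1).

Let S (w : seq T) := \sum_(x <- w) X x.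
Let N : R := (size l)%:R.

Lemma sum_words1 s : \sum_(w <- words l s) S w = 0.
Proof.
elim: s => [|s IH] /=; first by rewrite big_seq1 /S big_nil.
rewrite big_allpairs_dep /=.
under eq_bigr do under eq_bigr do rewrite /S big_cons -/(S _).
under eq_bigr do rewrite big_split /= IH addr0 big_const_seq count_predT iter_addr_0.
by rewrite sumrMnl X_centered mul0rn.
Qed.

(** The cross term vanishes by [sum_words1], so each draw adds at most 1 to the variance. *)
Lemma sum_words2 s : \sum_(w <- words l s) S w ^+ 2 <= s%:R * N ^+ s.
Proof.
elim: s => [|s IH] /=; first by rewrite big_seq1 /S big_nil expr0n mul0r.
rewrite big_allpairs_dep /=.
have step x : \sum_(w <- words l s) S (x :: w) ^+ 2 <= (s%:R + 1) * N ^+ s.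
  have -> : \sum_(w <- words l s) S (x :: w) ^+ 2 =
      N ^+ s * X x ^+ 2 + \sum_(w <- words l s) S w ^+ 2.
    transitivity (\sum_(w <- words l s) (X x ^+ 2 + (2 * X x * S w + S w ^+ 2))).
      by apply: eq_bigr => w _; rewrite /S big_cons; ring.
    rewrite !big_split /= -(mulr_sumr _ _ _ (2 * X x)) sum_words1 mulr0 add0r.
    by rewrite big_const_seq count_predT iter_addr_0 size_words -mulr_natl natrX.
  have X2 : X x ^+ 2 <= 1 by rewrite -real_normK ?num_real // expr_le1.
  have : 0 <= N ^+ s by rewrite exprn_ge0 // ler0n.
  nra.
apply: le_trans (ler_sum _ (fun x _ => step x)) _.
rewrite big_const_seq count_predT iter_addr_0 -mulr_natl -natr1 exprS -/N.
by rewrite le_eqVlt; apply/orP; left; apply/eqP; ring.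
Qed.

Lemma sum_words4 s : \sum_(w <- words l s) S w ^+ 4 <= 3 * s%:R ^+ 2 * N ^+ s.
Proof.
elim: s => [|s IH] /=; first by rewrite big_seq1 /S big_nil !expr0n mulr0 mul0r.
rewrite big_allpairs_dep /=.
set D := N ^+ s; set M3 := \sum_(w <- words l s) S w ^+ 3.
have D0 : 0 <= D by rewrite exprn_ge0 // ler0n.
(* The third moment [M3] is kept without any bound: its term is linear in [X x] and vanishes when
   summed over [x], since [X] is centered. *)
have step x : \sum_(w <- words l s) S (x :: w) ^+ 4 <=
    D + 6 * (s%:R * D) + 3 * s%:R ^+ 2 * D + 4 * M3 * X x.
  have -> : \sum_(w <- words l s) S (x :: w) ^+ 4 =
      D * X x ^+ 4 + (6 * X x ^+ 2 * \sum_(w <- words l s) S w ^+ 2 +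
        (4 * X x * M3 + \sum_(w <- words l s) S w ^+ 4)).
    transitivity (\sum_(w <- words l s) (X x ^+ 4 + (4 * X x ^+ 3 * S w +
      (6 * X x ^+ 2 * S w ^+ 2 + (4 * X x * S w ^+ 3 + S w ^+ 4))))).
      by apply: eq_bigr => w _; rewrite /S big_cons; ring.
    rewrite !big_split /= -(mulr_sumr _ _ _ (4 * X x ^+ 3)) sum_words1 mulr0 add0r.
    rewrite -(mulr_sumr _ _ _ (6 * X x ^+ 2)) -(mulr_sumr _ _ _ (4 * X x)).
    by rewrite big_const_seq count_predT iter_addr_0 size_words -[X x ^+ 4 *+ _]mulr_natl natrX.
  have X2 : X x ^+ 2 <= 1 by rewrite -real_normK ?num_real // expr_le1.
  have X4 : X x ^+ 4 <= 1 by rewrite (exprM _ 2 2) expr_le1 // sqr_ge0.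
  have X20 : 0 <= X x ^+ 2 by exact: sqr_ge0.
  have W0 : 0 <= \sum_(w <- words l s) S w ^+ 2.
    by apply: sumr_ge0 => w _; exact: sqr_ge0.
  have h1 : D * X x ^+ 4 <= D by rewrite ler_piMr.
  have h2 : X x ^+ 2 * \sum_(w <- words l s) S w ^+ 2 <= s%:R * D.
    by apply: le_trans (sum_words2 s); rewrite ler_piMl.
  move: IH h1 h2; rewrite -/D; lra.
apply: le_trans (ler_sum _ (fun x _ => step x)) _.
rewrite big_split /= -mulr_sumr X_centered mulr0 addr0.
rewrite big_const_seq count_predT iter_addr_0 -[_ *+ size l]mulr_natl -/N.
rewrite -[s.+1%:R]natr1 [N ^+ s.+1]exprS -/D.
have N0 : 0 <= N by rewrite ler0n.
have ND0 : 0 <= N * D by rewrite mulr_ge0.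
(* The slack is 3(s+1)^2 - (3s^2 + 6s + 1) = 2, times [N * D]. *)
rewrite -subr_ge0 [X in 0 <= X](_ : _ = 2 * (N * D)); first by rewrite mulr_ge0.
ring.
Qed.
End Moments.

(** * The algorithm for a fixed sample: correctness and cost *)

Definition sampling_tree {n} (l : seq 'I_n) (x0 : 'I_n) (i j q d1 d2 : nat)
    (w : seq 'I_n) : dtree n :=
  tsort d1 w (fun w' => trank (nth x0 w' q) l (fun r =>
    if (j <= r)%N && (r + i < size l)%N then Leaf (nth x0 w' q)
    else tsort d2 l (fun l' => Leaf (nth x0 l' j)))).

Definition good_pivot {n} (sigma : input n) (l : seq 'I_n) (i j : nat) (p : 'I_n) :=
  (j <= rank_in sigma l p)%N && (rank_in sigma l p + i < size l)%N.

Section SamplingTree.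
Variables (n : nat) (sigma : input n) (l : seq 'I_n) (x0 : 'I_n).
Variables (i j q d1 d2 : nat) (w : seq 'I_n).
Hypotheses (lew : (size w <= 2 ^ d1)%N) (lel : (size l <= 2 ^ d2)%N).

Let pivot := nth x0 (sort (rank_le sigma) w) q.

Lemma sampling_treeP (t := sampling_tree l x0 i j q d1 d2 w) :
  output t sigma = (if good_pivot sigma l i j pivot then pivot
                    else nth x0 (sort (rank_le sigma) l) j) /\
  (ncomparisons t sigma <=
    d1 * size w + size l + d2 * size l * ~~ good_pivot sigma l i j pivot)%N.
Proof.
rewrite {}/t /sampling_tree.
have [-> c1] := tsortP sigma d1 w (fun w' => trank (nth x0 w' q) l (fun r =>
    if (j <= r)%N && (r + i < size l)%N then Leaf (nth x0 w' q)
    else tsort d2 l (fun l' => Leaf (nth x0 l' j)))) lew.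
move: c1; rewrite -/pivot.
have [-> ->] := trankP sigma pivot l (fun r =>
    if (j <= r)%N && (r + i < size l)%N then Leaf pivot
    else tsort d2 l (fun l' => Leaf (nth x0 l' j))).
rewrite -/(good_pivot sigma l i j pivot); case: good_pivot => /=.
  by rewrite muln0 !addn0.
have [-> c2] := tsortP sigma d2 l (fun l' => Leaf (nth x0 l' j)) lel.
move=> c1; split=> //; apply: (leq_trans c1).
by rewrite muln1 -addnA !leq_add2l (leq_trans c2) //= addn0.
Qed.

(** Correctness holds for every sample [w] and index [q]: the pivot is output only after its exact
    rank in [l] is checked, and the fallback outputs the element of rank [j] in [l]. *)
Lemma sampling_tree_mediocre : uniq l -> (i + j < size l)%N ->
  mediocre i j sigma (output (sampling_tree l x0 i j q d1 d2 w) sigma).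
Proof.
move=> ul ij; have [-> _] := sampling_treeP.
have [/andP[]|_] := boolP (good_pivot _ _ _ _ _); first exact: mediocre_of_rank_in.
have jl : (j < size l)%N by lia.
by apply: (mediocre_of_rank_in sigma l) => //; rewrite rank_in_nth // addnC.
Qed.
End SamplingTree.

(** * Bad pivots, deviations of the sample, and total cost *)

(** The centered indicator of rank below [a]; its sum over a sample is the deviation of the count
    from its mean. *)
Definition rank_dev (R : realType) {n} (sigma : input n) (l : seq 'I_n) (a : nat)
    (x : 'I_n) : R :=
  (rank_in sigma l x < a)%N%:R - a%:R / (size l)%:R.

Section Deviation.
Variables (R : realType) (n : nat) (sigma : input n) (l : seq 'I_n).

Lemma sum_rank_dev a (w : seq 'I_n) :
  \sum_(x <- w) rank_dev R sigma l a x =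
  (count (fun x => rank_in sigma l x < a)%N w)%:R - (size w)%:R * (a%:R / (size l)%:R).
Proof.
rewrite big_split /= sumrN; congr (_ - _).
  by elim: w => [|x w IH] /=; rewrite ?big_nil // big_cons IH natrD.
by rewrite big_const_seq count_predT iter_addr_0 -[_ *+ size w]mulr_natl.
Qed.

Lemma rank_dev_centered a : uniq l -> (a <= size l)%N ->
  \sum_(x <- l) rank_dev R sigma l a x = 0.
Proof.
move=> ul al; rewrite sum_rank_dev count_rank_in_lt //.
have [l0|l0] := eqVneq (size l) 0%N.
  by move: al; rewrite l0 leqn0 => /eqP->; rewrite !mul0r subr0.
by rewrite mulrCA divff ?mulr1 ?subrr // pnatr_eq0.
Qed.

Lemma rank_dev_le1 a x : (a <= size l)%N -> `|rank_dev R sigma l a x| <= 1.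
Proof.
move=> al.
have c0 : 0 <= a%:R / (size l)%:R :> R by rewrite divr_ge0.
have c1 : a%:R / (size l)%:R <= 1 :> R.
  have [->|l0] := eqVneq (size l) 0%N; first by rewrite invr0 mulr0.
  by rewrite ler_pdivrMr ?mul1r ?ler_nat // ltr0n lt0n.
rewrite /rank_dev ler_norml; move: c0 c1; move: (_ / _) => c c0 c1.
by case: (_ < a)%N => /=; rewrite ?mulr0n ?mulr1n; apply/andP; split; lra.
Qed.

(* Summing the fourth powers of the two deviations covers both ways of being bad and
   turns Markov's inequality into a pointwise bound. *)
Lemma bad_pivot_dev x0 i j g w
    (q := ((size w * (j + g)) %/ size l)%N)
    (t := (size w)%:R * g%:R / (size l)%:R : R) :
  size l = (i + j + g.*2)%N -> (0 < g)%N -> (0 < size w)%N ->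
  ~~ good_pivot sigma l i j (nth x0 (sort (rank_le sigma) w) q) ->
  t ^+ 4 <= (\sum_(x <- w) rank_dev R sigma l j x) ^+ 4 +
            (\sum_(x <- w) rank_dev R sigma l (size l - i) x) ^+ 4.
Proof.
move=> sl g0 w0; set N := size l in q t sl *; set r := sort _ w; set p := nth _ _ _.
have N0 : (0 < N)%N by rewrite sl; lia.
have NR0 : 0 < N%:R :> R by rewrite ltr0n.
have qw : (q < size w)%N by rewrite ltn_divLR // ltn_pmul2l // sl; lia.
have t0 : 0 <= t by rewrite divr_ge0 // mulr_ge0.
(* The rank of the pivot in [l] is read off from sample counts, again by the prefix principle. *)
have key a : (rank_in sigma l p < a)%N = (q < count (fun x => rank_in sigma l x < a)%N w)%N.
  rewrite -(seq.permP (permEl (perm_sort (rank_le sigma) w))).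
  rewrite -(nth_sorted_downclosed (fun x => rank_in sigma l x < a)%N x0 _ q
    (@rank_le_trans _ sigma)) //.
  - by move=> x y xy; apply: leq_ltn_trans; exact: rank_in_le.
  - exact: sort_sorted (rank_le_total sigma) _.
  - by rewrite size_sort.
have pow4 (y : R) : t <= `|y| -> t ^+ 4 <= y ^+ 4.
  move=> ty; rewrite -[y ^+ 4]ger0_norm; first by rewrite normrX lerXn2r ?nnegrE.
  by rewrite (exprM _ 2 2) sqr_ge0.
rewrite negb_and -ltnNge -leqNgt => /orP[|bad].
  rewrite key => qc; apply: ler_wpDr; first by rewrite (exprM _ 2 2) sqr_ge0.
  apply: pow4; apply: le_trans (ler_norm _); rewrite sum_rank_dev -/N.
  (* Since [q] is a floor, a count of at least [q + 1] exceeds [size w * (j + g) / N], which is the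
     mean plus [t]. *)
  have : (size w * (j + g) <= count (fun x => rank_in sigma l x < j)%N w * N)%N.
    by apply: leq_trans (leq_mul qc (leqnn N)); rewrite ltnW // ltn_ceil.
  rewrite -(ler_nat R) !natrM natrD -(ler_pdivrMr _ _ NR0) => h.
  rewrite lerBrDr; apply: le_trans h; rewrite /t le_eqVlt; apply/orP; left.
  by apply/eqP; ring.
(* Good ranks run from [j] to just below [N - i = j + 2 * g], and [q] aims at the middle [j + g].
   Here at most [q] sampled elements lie below [N - i], a shortfall of at least [t]. *)
have : ~~ (rank_in sigma l p < N - i)%N by rewrite -leqNgt; lia.
rewrite key -leqNgt => qc; apply: ler_wpDl; first by rewrite (exprM _ 2 2) sqr_ge0.
apply: pow4; rewrite -normrN; apply: le_trans (ler_norm _); rewrite sum_rank_dev -/N.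
have : (count (fun x => rank_in sigma l x < N - i)%N w * N <= size w * (j + g))%N.
  by apply: leq_trans (leq_mul qc (leqnn N)) _; exact: leq_trunc_div.
rewrite -(ler_nat R) !natrM natrD -(ler_pdivlMr _ _ NR0) => h.
have -> : (N - i)%:R = j%:R + 2 * g%:R :> R.
  by rewrite sl -addnA addKn natrD -muln2 natrM mulrC.
rewrite opprB lerBrDr; apply: le_trans (lerD (lexx _) h) _; rewrite /t le_eqVlt.
by apply/orP; left; apply/eqP; ring.
Qed.
End Deviation.

(** The indicator of a bad pivot is at most the two fourth powers divided by [t ^+ 4]; two moments
    of [3 * s ^ 2] each give the 6. *)
Lemma sum_sampling_cost (R : realType) n (sigma : input n) (l : seq 'I_n) x0
    i j g s d1 d2 (N := size l) (q := ((s * (j + g)) %/ N)%N) :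
  uniq l -> N = (i + j + g.*2)%N -> (0 < g)%N -> (0 < s)%N ->
  (s <= 2 ^ d1)%N -> (N <= 2 ^ d2)%N ->
  \sum_(w <- words l s)
    (ncomparisons (sampling_tree l x0 i j q d1 d2 w) sigma)%:R <=
  N%:R ^+ s * ((d1 * s)%:R + N%:R +
    (d2 * N)%:R * (6 * s%:R ^+ 2 / (s%:R * g%:R / N%:R) ^+ 4)) :> R.
Proof.
move=> ul Nij g0 s0 ls lN.
set t := _ / N%:R.
have N0 : (0 < N)%N by rewrite Nij; lia.
have t0 : 0 < t by rewrite divr_gt0 ?mulr_gt0 ?ltr0n.
have t4 : 0 < t ^+ 4 by rewrite exprn_gt0.
pose S a w : R := \sum_(x <- w) rank_dev R sigma l a x.
have cost w : w \in words l s ->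
    (ncomparisons (sampling_tree l x0 i j q d1 d2 w) sigma)%:R <=
    (d1 * s)%:R + N%:R + (d2 * N)%:R / t ^+ 4 * (S j w ^+ 4 + S (N - i)%N w ^+ 4).
  move=> /size_mem_words sw.
  have lew : (size w <= 2 ^ d1)%N by rewrite sw.
  have [_ c] := sampling_treeP n sigma l x0 i j q d1 d2 w lew lN.
  move: c; rewrite -(ler_nat R) sw => /le_trans; apply.
  rewrite natrD natrD lerD2l natrM -mulrA ler_wpM2l //.
  rewrite mulrC ler_pdivlMr //.
  have [_|bad] := boolP (good_pivot _ _ _ _ _).
    by rewrite mul0r addr_ge0 // (exprM _ 2 2) sqr_ge0.
  have := bad_pivot_dev R n sigma l x0 i j g w Nij g0.
  by rewrite sw mul1r => /(_ s0 bad).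
have moment a : (a <= N)%N -> \sum_(w <- words l s) S a w ^+ 4 <= 3 * s%:R ^+ 2 * N%:R ^+ s.
  move=> aN; apply: sum_words4; first exact: rank_dev_centered.
  by move=> x; exact: rank_dev_le1.
rewrite big_seq; apply: le_trans (ler_sum _ cost) _; rewrite -big_seq.
rewrite big_split /= -mulr_sumr [X in _ + _ * X <= _]big_split /=.
rewrite big_const_seq count_predT iter_addr_0.
rewrite size_words -/N -[_ *+ (N ^ s)%N]mulr_natl natrX.
rewrite [X in _ <= X]mulrDr lerD2l.
have jN : (j <= N)%N by rewrite Nij; lia.
apply: le_trans (ler_wpM2l _ (lerD (moment _ jN) (moment _ (leq_subr i N)))) _.
  by rewrite divr_ge0 // ltW.
by rewrite le_eqVlt; apply/orP; left; apply/eqP; ring.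
Qed.

(** * Uniform distributions over finite lists of trees *)

Section Uniform.
Variables (R : realType) (n : nat).

(** [always_mediocre] also ranges over indices of weight 0, so the default tree [t0] has to be
    correct too. *)
Definition uniform_alg (t0 : dtree n) (ts : seq (dtree n)) : rand_alg R n :=
  RandAlg (fun k => if (k < size ts)%N then (size ts)%:R^-1 else 0) (nth t0 ts).

Lemma nneseries_finite_support (f : nat -> R) M :
  (forall k, 0 <= f k) -> (forall k, (M <= k)%N -> f k = 0) ->
  (\sum_(0 <= k <oo) (f k)%:E = (\sum_(0 <= k < M) f k)%:E)%E.
Proof.
move=> f0 fM; rewrite (nneseries_split 0 M) => [|k _]; last by rewrite lee_fin.
rewrite add0n eseries0 ?adde0 ?sumEFin // => k Mk _.
by rewrite fM.
Qed.

Lemma uniform_alg_distribution t0 ts :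
  (0 < size ts)%N -> is_distribution (uniform_alg t0 ts).
Proof.
move=> ts0; split=> [k|]; first by rewrite /=; case: ifP => _ //; rewrite invr_ge0.
rewrite (nneseries_finite_support _ (size ts)) /=; last 2 first.
- by move=> k; case: ifP => _ //; rewrite invr_ge0.
- by move=> k; rewrite leqNgt => /negbTE->.
congr (_%:E); under eq_big_nat => k /andP[_ ->] do [].
by rewrite sumr_const_nat subn0 -[_ *+ size ts]mulr_natl mulfV // pnatr_eq0 -lt0n.
Qed.

Lemma uniform_alg_expected t0 ts sigma :
  expected_comparisons (uniform_alg t0 ts) sigma =
  ((size ts)%:R^-1 * \sum_(t <- ts) (ncomparisons t sigma)%:R)%:E.
Proof.
rewrite /expected_comparisons (nneseries_finite_support _ (size ts)) /=; last 2 first.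
- by move=> k; rewrite mulr_ge0 //; case: ifP => _ //; rewrite invr_ge0.
- by move=> k; rewrite leqNgt => /negbTE->; rewrite mul0r.
congr (_%:E); rewrite (big_nth t0) mulr_sumr.
by apply: eq_big_nat => k /andP[_ ->].
Qed.
End Uniform.

(** * Choice of parameters and the final bound *)

(** The left side equals 150 N^5 / v^51, and N^5 is at most c^5 v^60. *)
Lemma failure_cost_le (R : realFieldType) (c v N : R) :
  0 < v -> 0 < N -> N <= c * v ^+ 12 ->
  25 * v * N * (6 * (v ^+ 8) ^+ 2 / (v ^+ 8 * v ^+ 9 / N) ^+ 4) <=
  150 * c ^+ 5 * v ^+ 9.
Proof.
move=> v0 N0 Nc.
have -> : 25 * v * N * (6 * (v ^+ 8) ^+ 2 / (v ^+ 8 * v ^+ 9 / N) ^+ 4) =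
    150 * N ^+ 5 / v ^+ 51 by field; rewrite ?gt_eqF.
rewrite ler_pdivrMr ?exprn_gt0 //.
have -> : 150 * c ^+ 5 * v ^+ 9 * v ^+ 51 = 150 * (c * v ^+ 12) ^+ 5 by ring.
by rewrite ler_wpM2l // lerXn2r ?nnegrE // ltW // (lt_le_trans N0).
Qed.

(** Twelfth powers make the orders m^(2/3) and m^(3/4) the integers [u ^ 8] and [u ^ 9]. The upper
    bound comes from maximality of [u] and u + 1 <= 2u. *)
Lemma twelfth_root (m : nat) : (0 < m)%N ->
  exists u : nat, [/\ (0 < u)%N, (u ^ 12 <= m)%N & (m <= 2 ^ 12 * u ^ 12)%N].
Proof.
move=> m0.
have ex0 : exists u : nat, (u ^ 12 <= m)%N by exists 1%N; rewrite exp1n.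
have ub (u : nat) : (u ^ 12 <= m)%N -> (u <= m)%N.
  by case: u => // u; apply: leq_trans; rewrite -{1}[u.+1]expn1 leq_pexp2l.
case: (ex_maxnP ex0 ub) => u um umax.
have u0 : (0 < u)%N by apply: umax; rewrite exp1n.
exists u; split=> //; rewrite -expnMn.
have : (m < u.+1 ^ 12)%N by rewrite ltnNge; apply/negP => /umax; rewrite ltnn.
by move/ltnW/leq_trans; apply; rewrite leq_exp2r //; lia.
Qed.

Theorem theorem2 (R : realType) :
  exists (C : R) (N0 : nat),
    forall (n i j : nat),
      (1 <= i)%N -> (1 <= j)%N -> (N0 <= i + j)%N ->
      (i + j)%:R + 2 * ((i + j)%:R `^ (3 / 4 : R)) <= n%:R :> R ->
      exists A : rand_alg R n,
        is_distribution A /\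
        always_mediocre i j A /\
        (forall sigma : input n,
           (expected_comparisons A sigma <=
            ((i + j)%:R + C * ((i + j)%:R `^ (3 / 4 : R)))%:E)%E).
Proof.
(* 10 is 2 from [N = i + j + 2 * u ^ 9] plus 8 from sorting the sample; the rest is the fallback,
   with [c = 2 ^+ 13] in [failure_cost_le]. *)
exists (10 + 150 * (2 ^+ 13) ^+ 5), 0%N => n i j i1 j1 _.
set P := _ `^ _ => hn.
have [u [u0 um mu]] := twelfth_root (i + j) (ltn_addr j i1).
have u9 : (u ^ 9)%:R <= P.
  have -> : (u ^ 9)%:R = (u ^ 12)%:R `^ (3 / 4) :> R.
    rewrite !natrX -!powR_mulrn ?ler0n // -powRrM; congr (_ `^ _); lra.
  by apply: ge0_ler_powR; rewrite ?nnegrE ?ler_nat //; lra.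
pose N := (i + j + (u ^ 9).*2)%N.
(* The assumed lower bound on [n] leaves room for the [N] retained elements. *)
have Nn : (N <= n)%N.
  rewrite -(ler_nat R) natrD -muln2 natrM; move: hn u9; rewrite -/P; lra.
have n0 : (0 < n)%N by apply: leq_trans Nn; rewrite /N; lia.
have g0 : (0 < u ^ 9)%N by rewrite expn_gt0 u0.
have s0 : (0 < u ^ 8)%N by rewrite expn_gt0 u0.
(* This crude bound stands in for logarithms: sorting [u ^ 8] elements at depth [8 * u] still costs
   only [8 * u ^ 9]. *)
have u2u : (u <= 2 ^ u)%N by rewrite ltnW // ltn_expl.
have sd : (u ^ 8 <= 2 ^ (8 * u))%N by rewrite mulnC expnM leq_exp2r.
have Nu : (N <= 2 ^ 13 * u ^ 12)%N.
  rewrite (expnS 2 12) -mulnA mul2n -addnn leq_add // -mul2n.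
  by rewrite leq_mul // ?leq_pexp2l // -{1}[2%N]expn1 leq_pexp2l.
(* 25 = 13 + 12, from the factors [2 ^ 13] and [u ^ 12]. *)
have Nd : (N <= 2 ^ (25 * u))%N.
  apply: leq_trans Nu _; rewrite (_ : 25 * u = 13 * u + u * 12)%N; last lia.
  by rewrite expnD leq_mul // ?leq_pexp2l ?leq_pmulr // expnM leq_exp2r.
pose l := take N (enum 'I_n); pose x0 := Ordinal n0.
have ul : uniq l by rewrite take_uniq ?enum_uniq.
have sl : size l = N by rewrite size_takel // size_enum_ord.
pose q := ((u ^ 8 * (j + u ^ 9)) %/ size l)%N.
pose T := sampling_tree l x0 i j q (8 * u) (25 * u).
have sT : size (map T (words l (u ^ 8))) = (N ^ (u ^ 8))%N.
  by rewrite size_map size_words sl.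
have N0 : (0 < N)%N by rewrite /N; lia.
exists (uniform_alg R n (T [::]) (map T (words l (u ^ 8)))); split; last split.
- by apply: uniform_alg_distribution; rewrite sT expn_gt0 N0.
- move=> k sigma /=.
  (* Indices past the list fall back to the tree of the empty sample, whose pivot is the default
     [x0]. *)
  have [w [szw ->]] : exists w, (size w <= 2 ^ (8 * u))%N /\
      nth (T [::]) (map T (words l (u ^ 8))) k = T w.
    have [lk|lk] := ltnP k (size (words l (u ^ 8))).
      exists (nth [::] (words l (u ^ 8)) k); rewrite (nth_map [::]) //; split=> //.
      by rewrite (size_mem_words _ _ _ (mem_nth [::] lk)).
    by exists [::]; rewrite nth_default // size_map.
  by apply: sampling_tree_mediocre; rewrite ?sl // /N; lia.
move=> sigma; rewrite uniform_alg_expected sT big_map lee_fin natrX.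
rewrite ler_pdivrMl ?exprn_gt0 ?ltr0n //.
have lN : (size l <= 2 ^ (25 * u))%N by rewrite sl.
have := sum_sampling_cost R n sigma l x0 i j _ _ _ _ ul sl g0 s0 sd lN.
rewrite -/q -/T sl => /le_trans; apply.
rewrite ler_wpM2l ?exprn_ge0 //.
have NR : N%:R <= 2 ^+ 13 * u%:R ^+ 12 :> R by rewrite -!natrX -natrM ler_nat.
have uR : 0 < u%:R :> R by rewrite ltr0n.
have NR0 : 0 < N%:R :> R by rewrite ltr0n.
have := failure_cost_le R _ _ _ uR NR0 NR.
move: u9; rewrite [(8 * u * _)%:R]natrM [(8 * u)%:R]natrM [(25 * u * _)%:R]natrM.
rewrite [(25 * u)%:R]natrM [(u ^ 8)%:R]natrX [(u ^ 9)%:R]natrX.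
set F := 25 * _ * _ * _ => u9 hF.
have NE : N%:R = (i + j)%:R + 2 * u%:R ^+ 9 :> R.
  by rewrite /N natrD -muln2 natrM natrX mulrC.
have hK : 150 * (2 ^+ 13) ^+ 5 * u%:R ^+ 9 <= 150 * (2 ^+ 13) ^+ 5 * P.
  by rewrite ler_wpM2l // mulr_ge0 // exprn_ge0 // exprn_ge0.
have -> : 8 * u%:R * u%:R ^+ 8 = 8 * u%:R ^+ 9 :> R by rewrite -mulrA -exprS.
rewrite NE [(10 + _) * P]mulrDl; move: hF hK u9.
move: (u%:R ^+ 9) (150 * _ * P) (150 * _ * u%:R ^+ 9) F => v a b f.
lra.
Qed.
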